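(* Let $\mathcal{B}=\{u_1,\dots,u_N\}$ be an orthonormal basis of $\mathbb{K}^N$, with associated unitary matrix $U$, let $X$ be a Banach space over $\mathbb{K}$, and let $p,q\in[1,\infty]$, with $p'$ the conjugate exponent of $p$. Then for every $f\in X^N$, $$\|\hat f\|_q\le\|U\|_{p',q}\,\|f\|_p,\qquad \|f\|_q\le\|U^*\|_{p',q}\,\|\hat f\|_p .$$ In particular, for every $f\in X^N$, $$\|\hat f\|_2\le\sqrt N\,\|f\|_2,\qquad \|f\|_2\le\sqrt N\,\|\hat f\|_2 .$$ Consequently, $\mathcal{F}:L^p(V,X)\to L^q(V,X)$ is a topological isomorphism, and its operator norm satisfies $$\|\mathcal{F}\|_{p\to q}\le\|U\|_{p',q}.$$
   Context: $\mathbb{K}$ is $\mathbb{R}$ or $\mathbb{C}$, $N\ge 1$, $V=\{1,\dots,N\}$. An $X$-valued signal is a function $f:V\to X$, identified with $(f(1),\dots,f(N))\in X^N$. Norms: $\|f\|_p=\left(\sum_{n=1}^N\|f(n)\|^p\right)^{1/p}$ for $p\in[1,\infty)$ and $\|f\|_\infty=\max_{1\le n\le N}\|f(n)\|$; $L^p(V,X)$ denotes $X^N$ with $\|\cdot\|_p$. $U$ is the $N\times N$ unitary matrix whose $k$-th column is $u_k=(u_k(1),\dots,u_k(N))$, i.e. its entry in row $n$, column $k$ is $u_k(n)$; its $n$-th row is $u(n)=(u_1(n),\dots,u_N(n))$; $U^*$ is its conjugate transpose. Graph Fourier transform: $\mathcal{F}:X^N\to X^N$, $\mathcal{F}f=\hat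 f$, $\hat f(k)=\sum_{n=1}^N\overline{u_k(n)}f(n)$. Mixed norms: for $a,b\in[1,\infty]$, $\|U\|_{a,b}=\left(\sum_{k=1}^N\left(\sum_{n=1}^N|u_k(n)|^a\right)^{b/a}\right)^{1/b}$, i.e. the $\ell^b$ norm over $k$ of the $\ell^a$ norms of the columns $u_k$, with the usual modifications (maxima) when $a=\infty$ or $b=\infty$; hence $\|U^*\|_{a,b}$ is the $\ell^b$ norm over $n$ of the $\ell^a$ norms of the rows $u(n)$. The conjugate exponent satisfies $1/p+1/p'=1$. A topological isomorphism is a linear bijection that is continuous with continuous inverse; $\|\cdot\|_{p\to q}$ is the operator norm from $L^p(V,X)$ to $L^q(V,X)$. *)

(* Defs.v *)
From HB Require Import structures.
From mathcomp Require Import all_boot all_order all_algebra.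
From mathcomp Require Import complex.
From mathcomp Require Import all_classical all_reals all_analysis.

Set Implicit Arguments.
Unset Strict Implicit.
Unset Printing Implicit Defensive.

Import Order.TTheory GRing.Theory Num.Theory.
Import numFieldNormedType.Exports.

Local Open Scope ring_scope.

Variant scalar_kind := RealScalars | ComplexScalars.

Definition scalars (R : realType) (k : scalar_kind) : numFieldType :=
  match k with
  | RealScalars => R
  | ComplexScalars => R[i]
  end.

Definition conj_scalar (R : realType) (k : scalar_kind) :
    scalars R k -> scalars R k :=
  match k return scalars R k -> scalars R k with
  | RealScalars => id
  | ComplexScalars => @conjc R
  end.

Definition re_scalar (R : realType) (k : scalar_kind) : scalars R k -> R :=
  match k return scalars R k -> R with
  | RealScalars => id
  | ComplexScalars => @complex.Re R
  end.

(* The norm of a normed space over R[i] takes its values in R[i] (they are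
   nonnegative, hence have a zero imaginary part); [norm_re] reads the norm
   back in R. It applies to vectors as well as to scalars. *)
Definition norm_re (R : realType) (k : scalar_kind)
    (V : normedZmodType (scalars R k)) (x : V) : R :=
  re_scalar `|x|.

(* Only used for exponents p >= 1; the value at -oo is junk. *)
Definition lp (R : realType) (p : \bar R) (I : finType) (a : I -> R) : R :=
  match p with
  | r%:E => (\sum_i `|a i| `^ r) `^ r^-1
  | +oo%E => \big[Num.max/0]_i `|a i|
  | -oo%E => 0
  end.

Definition signal_norm (R : realType) (k : scalar_kind)
    (X : normedModType (scalars R k)) (N : nat) (p : \bar R)
    (f : {ffun 'I_N -> X}) : R :=
  lp p (fun n => norm_re (f n)).

Definition mixed_norm (R : realType) (k : scalar_kind) (N : nat)
    (a b : \bar R) (A : 'M[scalars R k]_N) : R :=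
  lp b (fun j => lp a (fun n => norm_re (A n j))).

Definition conj_trmx (R : realType) (k : scalar_kind) (N : nat)
    (A : 'M[scalars R k]_N) : 'M[scalars R k]_N :=
  map_mx (@conj_scalar R k) A^T.

Definition inner (R : realType) (k : scalar_kind) (N : nat)
    (x y : 'cV[scalars R k]_N) : scalars R k :=
  \sum_n x n 0 * conj_scalar (y n 0).

Definition orthonormal_basis (R : realType) (k : scalar_kind) (N : nat)
    (u : 'I_N -> 'cV[scalars R k]_N) : Prop :=
  basis_of fullv [seq u j | j <- enum 'I_N] /\
  forall i j, inner (u i) (u j) = (i == j)%:R.

Definition basis_mx (R : realType) (k : scalar_kind) (N : nat)
    (u : 'I_N -> 'cV[scalars R k]_N) : 'M[scalars R k]_N :=
  \matrix_(n, j) u j n 0.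

Definition graph_fourier (R : realType) (k : scalar_kind)
    (X : normedModType (scalars R k)) (N : nat)
    (u : 'I_N -> 'cV[scalars R k]_N) (f : {ffun 'I_N -> X}) :
    {ffun 'I_N -> X} :=
  [ffun j => \sum_n conj_scalar (u j n 0) *: f n].

Definition lp_continuous (R : realType) (k : scalar_kind)
    (X : normedModType (scalars R k)) (N : nat) (p q : \bar R)
    (T : {ffun 'I_N -> X} -> {ffun 'I_N -> X}) : Prop :=
  forall f (e : R), 0 < e -> exists2 d : R, 0 < d &
    forall g, signal_norm p (g - f) < d -> signal_norm q (T g - T f) < e.

Definition topological_isomorphism (R : realType) (k : scalar_kind)
    (X : normedModType (scalars R k)) (N : nat) (p q : \bar R)
    (T : {ffun 'I_N -> X} -> {ffun 'I_N -> X}) : Prop :=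
  [/\ linear T, lp_continuous p q T &
      exists S : {ffun 'I_N -> X} -> {ffun 'I_N -> X},
        [/\ cancel T S, cancel S T & lp_continuous q p S]].

Definition operator_norm (R : realType) (k : scalar_kind)
    (X : normedModType (scalars R k)) (N : nat) (p q : \bar R)
    (T : {ffun 'I_N -> X} -> {ffun 'I_N -> X}) : \bar R :=
  ereal_sup [set (signal_norm q (T f))%:E | f in
               [set f : {ffun 'I_N -> X} | signal_norm p f <= 1]].

(* Main.v *)
Require Import Defs.
From HB Require Import structures.
From mathcomp Require Import all_boot all_order all_algebra.
From mathcomp Require Import complex.
From mathcomp Require Import all_classical all_reals all_analysis.
Import Order.TTheory GRing.Theory Num.Theory.
Import numFieldNormedType.Exports.
Local Open Scope ring_scope.

(** The transform is the action of the matrix [U^*] on [X]-valued signals, and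
    the orthonormality of the basis says that [U^* U = 1], hence also
    [U U^* = 1]; so the action of [U] inverts the transform.  Both inequalities
    are therefore instances of a single bound, valid for an arbitrary scalar
    matrix [A]: by the triangle inequality and the finite Hoelder inequality
    ([hoelder_sum]), the [j]-th value of [A f] has norm at most the
    [l^p'] norm of the [j]-th row of [A] times the [l^p] norm of [f], and taking
    [l^q] norms over [j] gives [matrix_op_bound].  The rows of [U^*] are the
    conjugate columns of [U], which turns the constant into a mixed norm of [U].

    For [p = q = 2] the constant is the Frobenius norm of [U], that is the square
    root of the trace of [U U^* = 1], namely [sqrt N].  Continuity of both
    directions follows from the same bound applied to differences of signals,
    with the exponents [(p, q)] for the transform and [(q, p)] for its inverse;
    the operator norm estimate is the bound on the unit ball. *)

(** * Finite l^p norms and the Hoelder inequality *)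

Section LpNorm.
Context {R : realType} {I : finType}.
Implicit Types (p : \bar R) (a b : I -> R).

Lemma lp_ge0 p a : 0 <= lp p a.
Proof.
case: p => [r| |] //=; first exact: powR_ge0.
by elim/big_rec: _ => // i x _ x0; rewrite le_max normr_ge0.
Qed.

Lemma lp_component p a i : (1%:E <= p)%E -> `|a i| <= lp p a.
Proof.
case: p => [r| |] //=; last first.
  by move=> _; apply: (le_bigmax _ (fun j => `|a j|)).
rewrite lee_fin => r1; have r0 : 0 < r by apply: lt_le_trans r1.
have -> : `|a i| = (`|a i| `^ r) `^ r^-1.
  by rewrite -powRrM mulfV ?gt_eqF// powRr1.
apply: ge0_ler_powR; rewrite ?invr_ge0 ?(ltW r0)// ?nnegrE ?powR_ge0 ?sumr_ge0//.
by rewrite (bigD1 i)//= lerDl sumr_ge0.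
Qed.

Lemma le_lp p a b : (1%:E <= p)%E -> (forall i, `|a i| <= `|b i|) ->
  lp p a <= lp p b.
Proof.
case: p => [r p1 ab|_ ab|]; [|by apply: le_bigmax2 => i _; exact: ab|by []].
rewrite /=.
have r0 : 0 < r by move: p1; rewrite lee_fin; exact: lt_le_trans.
have sum0 (c : I -> R) : 0 <= \sum_i `|c i| `^ r.
  by apply: sumr_ge0 => j _; exact: powR_ge0.
apply: ge0_ler_powR; rewrite ?invr_ge0 ?(ltW r0)// ?nnegrE ?sum0//.
by apply: ler_sum => i _; apply: ge0_ler_powR; rewrite ?nnegrE// (ltW r0).
Qed.

Lemma lpZr p a (c : R) : (1%:E <= p)%E -> 0 <= c ->
  lp p (fun i => a i * c) = lp p a * c.
Proof.
case: p => [r| |] //= p1 c0; last first.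
  elim/big_ind2: _ => [|x x' y y' -> ->|i _]; first by rewrite mul0r.
    by rewrite maxr_pMl.
  by rewrite normrM (ger0_norm c0).
have r0 : 0 < r by move: p1; rewrite lee_fin; exact: lt_le_trans.
under eq_bigr do rewrite normrM (ger0_norm c0) powRM//.
rewrite -mulr_suml powRM ?powR_ge0//; last first.
  by apply: sumr_ge0 => j _; exact: powR_ge0.
by rewrite -powRrM mulfV ?gt_eqF// powRr1.
Qed.

Lemma lp2E a : lp 2%:E a = Num.sqrt (\sum_i a i ^+ 2).
Proof.
rewrite /= powR12_sqrt; last by apply: sumr_ge0 => j _; exact: powR_ge0.
by congr Num.sqrt; apply: eq_bigr => i _; rewrite powR_mulrn// real_normK ?num_real.
Qed.

Lemma lp1E a : lp 1%:E a = \sum_i `|a i|.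
Proof.
rewrite /= invr1; under eq_bigr do rewrite powRr1//.
by rewrite powRr1// sumr_ge0.
Qed.

Lemma lp_powR (r : R) a : 0 < r -> lp r%:E a `^ r = \sum_i `|a i| `^ r.
Proof.
move=> r0; rewrite /= -powRrM mulVf ?gt_eqF// powRr1//.
by apply: sumr_ge0 => j _; exact: powR_ge0.
Qed.

Lemma hoelder_sum_max a b :
  \sum_i `|a i| * `|b i| <= lp +oo a * lp 1%:E b.
Proof.
rewrite lp1E mulr_sumr; apply: ler_sum => i _; apply: ler_wpM2r => //.
exact: lp_component (leey _).
Qed.

Lemma lp_eq0 p a : (1%:E <= p)%E -> lp p a = 0 -> forall i, a i = 0.
Proof.
move=> p1 a0 i; apply/eqP; rewrite -normr_le0 -a0; exact: lp_component.
Qed.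

(** For nonzero vectors, normalise both to norm one and sum the pointwise
    Young inequality; the right-hand sides then add up to [1/r + 1/s = 1]. *)
Lemma hoelder_sum_fin (r s : R) a b : 1 <= r -> 1 <= s ->
  r^-1 + s^-1 = 1 -> \sum_i `|a i| * `|b i| <= lp r%:E a * lp s%:E b.
Proof.
move=> r1 s1 rs.
have r0 : 0 < r by apply: lt_le_trans r1.
have s0 : 0 < s by apply: lt_le_trans s1.
have [A0|An0] := eqVneq (lp r%:E a) 0.
  rewrite A0 mul0r big1// => i _.
  by rewrite (lp_eq0 r%:E a)// ?normr0 ?mul0r ?lee_fin.
have [B0|Bn0] := eqVneq (lp s%:E b) 0.
  rewrite B0 mulr0 big1// => i _.
  by rewrite (lp_eq0 s%:E b)// ?normr0 ?mulr0 ?lee_fin.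
have Ap : 0 < lp r%:E a by rewrite lt_def An0 lp_ge0.
have Bp : 0 < lp s%:E b by rewrite lt_def Bn0 lp_ge0.
have unit_sum (t : R) (c : I -> R) : 0 < t -> 0 < lp t%:E c ->
    \sum_i (`|c i| / lp t%:E c) `^ t / t = t^-1.
  move=> t0 C0; have normalised : \sum_i (`|c i| / lp t%:E c) `^ t = 1.
    under eq_bigr do rewrite powRM ?invr_ge0 ?(ltW C0)//.
    rewrite -mulr_suml -lp_powR// -powRM ?invr_ge0 ?(ltW C0)//.
    by rewrite divff ?gt_eqF// powR1.
  by rewrite -[RHS]mul1r -normalised mulr_suml.
have AB : 0 < lp r%:E a * lp s%:E b by exact: mulr_gt0 Ap Bp.
suff : (\sum_i `|a i| * `|b i|) / (lp r%:E a * lp s%:E b) <= 1.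
  by rewrite (ler_pdivrMr _ _ AB) mul1r.
rewrite mulr_suml.
rewrite -rs -(unit_sum r a r0 Ap) -(unit_sum s b s0 Bp) -big_split.
apply: ler_sum => i _; rewrite invfM mulrACA.
have normalised_ge0 (t : R) (c : I -> R) : 0 <= `|c i| / lp t%:E c.
  exact: divr_ge0 (normr_ge0 _) (lp_ge0 _ _).
exact: conjugate_powR (normalised_ge0 r a) (normalised_ge0 s b) r0 s0 rs.
Qed.

Lemma hoelder_sum p a b : (1%:E <= p)%E ->
  \sum_i `|a i| * `|b i| <= lp (hoelder_conjugate p) a * lp p b.
Proof.
move=> p1; have [->|pn1] := eqVneq p 1%:E.
  by rewrite hoelder_conjugate1; exact: hoelder_sum_max.
have [->|pny] := eqVneq p +oo%E.
  rewrite hoelder_conjugatey mulrC.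
  by under eq_bigr do rewrite mulrC; exact: hoelder_sum_max.
case: p p1 pn1 pny => [r| |] // p1 pn1 _.
have q1 : (1 <= hoelder_conjugate r%:E)%E by exact: hoelder_conj_ge1.
have r0 : 0 < r by move: p1; rewrite lee_fin; exact: lt_le_trans.
have := @hoelder_conjugate_eq1 R r%:E (ltNyr _).
case E : (hoelder_conjugate r%:E) q1 => [s| |] // s1; last first.
  by move/hoelder_conjugate_eqy: E pn1 => ->; rewrite eqxx.
have s0 : 0 < s by move: s1; rewrite lee_fin; exact: lt_le_trans.
rewrite !inver !gt_eqF// => /(_ isT) [rs].
by apply: hoelder_sum_fin; rewrite -?lee_fin// addrC.
Qed.

End LpNorm.

(** * Real-valued norms over either scalar field *)

Section ScalarNorm.
Context {R : realType} {k : scalar_kind}.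
Implicit Types x y z : scalars R k.

Lemma re_scalarD x y : re_scalar (x + y) = re_scalar x + re_scalar y.
Proof. by case: k x y => //= -[a b] [c d]. Qed.

Lemma re_scalar_nat n : re_scalar (n%:R : scalars R k) = n%:R.
Proof.
elim: n => [|n IH]; first by case: (k).
by rewrite -!natr1 re_scalarD IH; case: (k).
Qed.

Lemma le_re_scalar x y : x <= y -> re_scalar x <= re_scalar y.
Proof. by case: k x y => //= x y; rewrite lecE => /andP[]. Qed.

(** Multiplicativity of the real part needs only one factor to be real; the
    norms, being nonnegative scalars, are. *)
Lemma re_scalarM x y : 0 <= x -> re_scalar (x * y) = re_scalar x * re_scalar y.
Proof.
case: k x y => //= -[a b] [c d]; rewrite lecE/= => /andP[/eqP -> _].
by rewrite mul0r subr0.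
Qed.

Lemma conj_scalarM_norm z : z * conj_scalar z = `|z| ^+ 2.
Proof.
case: k z => /= z; first by rewrite real_normK ?num_real.
exact: esym (sqr_normc z).
Qed.

Lemma norm_conj_scalar z : `|conj_scalar z| = `|z|.
Proof. case: k z => //= z; exact: normcJ. Qed.

Lemma norm_re_ge0 {V : normedZmodType (scalars R k)} (x : V) : 0 <= norm_re x.
Proof.
have <- : re_scalar (0 : scalars R k) = 0 by exact: (re_scalar_nat 0).
exact: le_re_scalar.
Qed.

Lemma ler_norm_re_sum {V : normedZmodType (scalars R k)} {I : finType}
    (f : I -> V) :
  norm_re (\sum_i f i) <= \sum_i norm_re (f i).
Proof.
have le0 : re_scalar (0 : scalars R k) = 0 by exact: (re_scalar_nat 0).
elim/big_ind2: _ => [|x x' y y' hx hy|//]; first by rewrite /norm_re normr0 le0.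
apply: le_trans (lerD hx hy).
by rewrite /norm_re -re_scalarD; apply/le_re_scalar/ler_normD.
Qed.

Lemma norm_reZ {X : normedModType (scalars R k)} z (x : X) :
  norm_re (z *: x) = norm_re z * norm_re x.
Proof. by rewrite /norm_re normrZ re_scalarM. Qed.

Lemma norm_re_sqr z : norm_re z ^+ 2 = re_scalar (z * conj_scalar z).
Proof. by rewrite conj_scalarM_norm !expr2 re_scalarM. Qed.

End ScalarNorm.

(** * Scalar matrices acting on vector-valued signals *)

Section MatrixOperator.
Context {R : realType} {k : scalar_kind} {X : normedModType (scalars R k)}.
Context {N : nat}.
Implicit Types (A B : 'M[scalars R k]_N) (f g : {ffun 'I_N -> X}).

Definition matrix_op A f : {ffun 'I_N -> X} :=
  [ffun j => \sum_n A j n *: f n].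

Lemma matrix_op_linear A : linear (matrix_op A).
Proof.
move=> c f g; apply/ffunP => j; rewrite !ffunE scaler_sumr -big_split/=.
by apply: eq_bigr => n _; rewrite !ffunE scalerDr !scalerA mulrC.
Qed.

Lemma matrix_opM A B f : matrix_op A (matrix_op B f) = matrix_op (A *m B) f.
Proof.
apply/ffunP => j; rewrite !ffunE.
under eq_bigr do rewrite ffunE scaler_sumr.
rewrite exchange_big/=; apply: eq_bigr => n _.
by rewrite mxE scaler_suml; apply: eq_bigr => m _; rewrite scalerA.
Qed.

Lemma matrix_op1 f : matrix_op 1%:M f = f.
Proof.
apply/ffunP => j; rewrite ffunE (bigD1 j)//= big1 => [|n nj].
  by rewrite mxE eqxx scale1r addr0.
by rewrite mxE eq_sym (negbTE nj) scale0r.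
Qed.

Lemma matrix_opK A B : A *m B = 1%:M -> cancel (matrix_op B) (matrix_op A).
Proof. by move=> AB f; rewrite matrix_opM AB matrix_op1. Qed.

(** The transpose appears because the Hoelder inequality involves the rows of
    [A], whereas a mixed norm takes its inner norms along columns. *)
Lemma matrix_op_bound p q A f : (1%:E <= p)%E -> (1%:E <= q)%E ->
  signal_norm q (matrix_op A f) <=
    mixed_norm (hoelder_conjugate p) q A^T * signal_norm p f.
Proof.
move=> p1 q1; rewrite /mixed_norm -lpZr ?lp_ge0//; apply: le_lp => // j.
rewrite [X in X <= _]ger0_norm ?norm_re_ge0//.
rewrite [X in _ <= X]ger0_norm ?mulr_ge0 ?lp_ge0//.
apply: le_trans (hoelder_sum _ _ _ p1); rewrite ffunE.
apply: le_trans (ler_norm_re_sum _) _; apply: ler_sum => n _.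
by rewrite norm_reZ mxE !ger0_norm ?norm_re_ge0.
Qed.

(** By linearity the bound is a Lipschitz estimate.  Its constant [C] may
    vanish, so [e / (C + 1)] rather than [e / C] serves as the modulus. *)
Lemma matrix_op_continuous p q A : (1%:E <= p)%E -> (1%:E <= q)%E ->
  lp_continuous p q (matrix_op A).
Proof.
move=> p1 q1 f e e0; pose C := mixed_norm (hoelder_conjugate p) q A^T.
have C0 : 0 < C + 1 by rewrite ltr_wpDl// lp_ge0.
exists (e / (C + 1)) => [|g]; first by rewrite divr_gt0.
rewrite ltr_pdivlMr// => fg.
have -> : matrix_op A g - matrix_op A f = matrix_op A (g - f).
  by rewrite [g - f]addrC -[- f]scaleN1r matrix_op_linear scaleN1r addrC.
apply: le_lt_trans fg; apply: le_trans (matrix_op_bound p q A _ p1 q1) _.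
by rewrite mulrC ler_wpM2l ?lp_ge0// lerDl.
Qed.

Lemma operator_norm_le p q (T : {ffun 'I_N -> X} -> {ffun 'I_N -> X}) (C : R) :
  0 <= C -> (forall f, signal_norm q (T f) <= C * signal_norm p f) ->
  (operator_norm p q T <= C%:E)%E.
Proof.
move=> C0 TC; apply: ge_ereal_sup => _ [f /= f1 <-]; rewrite lee_fin.
by apply: le_trans (TC f) _; rewrite ler_piMr.
Qed.

End MatrixOperator.

(** * The unitary matrix of an orthonormal basis *)

Section UnitaryMatrix.
Context {R : realType} {k : scalar_kind} {N : nat}.
Implicit Types A : 'M[scalars R k]_N.

Lemma conj_trmxK A : conj_trmx (conj_trmx A) = A.
Proof.
apply/matrixP => i j; rewrite !mxE.
by case: k A => // A; rewrite /= conjcK.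
Qed.

Lemma mixed_norm_conj p q A :
  mixed_norm p q (conj_trmx A) = mixed_norm p q A^T.
Proof.
congr lp; apply/funext => j; congr lp; apply/funext => n.
by rewrite !mxE /norm_re norm_conj_scalar.
Qed.

(** With both exponents equal to 2 the mixed norm is the Frobenius norm. *)
Lemma mixed_norm22 A :
  mixed_norm 2%:E 2%:E A = Num.sqrt (re_scalar (\tr (A *m conj_trmx A))).
Proof.
rewrite /mixed_norm lp2E; congr Num.sqrt.
have sqr_lp2 (a : 'I_N -> R) : lp 2%:E a ^+ 2 = \sum_i a i ^+ 2.
  by rewrite lp2E sqr_sqrtr ?sumr_ge0// => i _; exact: sqr_ge0.
under eq_bigr do rewrite sqr_lp2.
have re_sum (F : 'I_N -> scalars R k) :
    re_scalar (\sum_i F i) = \sum_i re_scalar (F i).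
  apply: (big_morph _ re_scalarD); exact: (re_scalar_nat 0).
rewrite exchange_big/= /mxtrace re_sum; apply: eq_bigr => n _.
by rewrite mxE re_sum; apply: eq_bigr => j _; rewrite !mxE norm_re_sqr.
Qed.

Context {u : 'I_N -> 'cV[scalars R k]_N} (hu : orthonormal_basis u).

Lemma basis_mx_unitaryl : conj_trmx (basis_mx u) *m basis_mx u = 1%:M.
Proof.
apply/matrixP => i j; rewrite !mxE eq_sym -hu.2.
by apply: eq_bigr => n _; rewrite !mxE mulrC.
Qed.

Lemma basis_mx_unitaryr : basis_mx u *m conj_trmx (basis_mx u) = 1%:M.
Proof. exact: mulmx1C basis_mx_unitaryl. Qed.

Lemma graph_fourierE (X : normedModType (scalars R k)) :
  graph_fourier u = @matrix_op R k X N (conj_trmx (basis_mx u)).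
Proof.
apply/funext => f; apply/ffunP => j; rewrite !ffunE.
by apply: eq_bigr => n _; rewrite !mxE.
Qed.

End UnitaryMatrix.

Lemma mixed_norm22_unitary {R : realType} {k : scalar_kind} {N : nat}
    (A : 'M[scalars R k]_N) :
  A *m conj_trmx A = 1%:M -> mixed_norm 2%:E 2%:E A = Num.sqrt N%:R.
Proof. by move=> A1; rewrite mixed_norm22 A1 mxtrace1 re_scalar_nat. Qed.

Theorem theorem2p3 (R : realType) (k : scalar_kind) (N : nat) (hN : (0 < N)%N)
    (u : 'I_N -> 'cV[scalars R k]_N) (hu : orthonormal_basis u)
    (X : completeNormedModType (scalars R k)) (p q : \bar R)
    (hp : (1%:E <= p)%E) (hq : (1%:E <= q)%E) :
  let U := basis_mx u in
  let F := @graph_fourier R k X N u in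
  let p' := hoelder_conjugate p in
  [/\ forall f : {ffun 'I_N -> X},
        signal_norm q (F f) <= mixed_norm p' q U * signal_norm p f /\
        signal_norm q f <= mixed_norm p' q (conj_trmx U) * signal_norm p (F f),
      forall f : {ffun 'I_N -> X},
        signal_norm 2%:E (F f) <= Num.sqrt N%:R * signal_norm 2%:E f /\
        signal_norm 2%:E f <= Num.sqrt N%:R * signal_norm 2%:E (F f),
      topological_isomorphism p q F &
      (operator_norm p q F <= (mixed_norm p' q U)%:E)%E].
Proof.
move=> U F p'; have FE : F = matrix_op (conj_trmx U) by exact: graph_fourierE.
have UUs : U *m conj_trmx U = 1%:M by exact: basis_mx_unitaryr.
have UsU : conj_trmx U *m U = 1%:M by exact: basis_mx_unitaryl.
have trU a b : mixed_norm a b (conj_trmx U) = mixed_norm a b U^T.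
  exact: mixed_norm_conj.
have trUs a b : mixed_norm a b (conj_trmx U)^T = mixed_norm a b U.
  by rewrite -mixed_norm_conj conj_trmxK.
have bound r s (f : {ffun 'I_N -> X}) : (1%:E <= r)%E -> (1%:E <= s)%E ->
    signal_norm s (F f) <=
      mixed_norm (hoelder_conjugate r) s U * signal_norm r f /\
    signal_norm s f <=
      mixed_norm (hoelder_conjugate r) s (conj_trmx U) * signal_norm r (F f).
  move=> r1 s1; split.
    by rewrite -trUs FE; exact: matrix_op_bound.
  rewrite trU -{1}[f](matrix_opK _ _ UUs) -FE; exact: matrix_op_bound.
split.
- by move=> f; exact: bound.
- move=> f; have one2 : (1%:E <= 2%:E :> \bar R)%E by rewrite lee_fin ler1n.
  have := bound _ _ f one2 one2; rewrite hoelder_conjugate2.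
  by rewrite !mixed_norm22_unitary// conj_trmxK.
- rewrite FE; split; first exact: matrix_op_linear.
    exact: matrix_op_continuous.
  exists (matrix_op U); split; [exact: matrix_opK|exact: matrix_opK|].
  exact: matrix_op_continuous.
- by apply: operator_norm_le => [|f]; [exact: lp_ge0|exact: (bound _ _ f hp hq).1].
Qed.
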